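(* Let $X\in\mathfrak{sl}_n^{(1)}(\mathbb C)$ be a nilpotent element. Then there exists $g\in\overline{\mathfrak L}(\mathrm{Sl}_n(\mathbb C))$ such that $$\mathrm{Ad}\,g(X)=D(J_{\overline p_{1},i_1},\dots,J_{\overline p_{d},i_d})+\lambda c$$ for some $d\in\mathbb N$, $\overline p_{k}\in\mathcal K^{i_k-1}$ and $\lambda\in\mathbb C$, where $D(J_{\overline p_{1},i_1},\dots,J_{\overline p_{d},i_d})$ is a quasi-Jordan matrix.
   Context: $\mathcal K=\mathbb C[[t]][t^{-1}]$ is the field of formal Laurent series. The affine Kac-Moody algebra is $\mathfrak g=\mathfrak{sl}_n^{(1)}(\mathbb C)=(\mathbb C[t,t^{-1}]\otimes\mathfrak{sl}_n(\mathbb C))\oplus\mathbb Cc\oplus\mathbb Cd$, with completion $\hat{\mathfrak g}=\mathfrak{sl}_n(\mathcal K)\oplus\mathbb Cc\oplus\mathbb Cd$, both with bracket $$[x+\lambda c+\mu d,\ y+\lambda' c+\mu' d]=[x,y]+\mu t\tfrac{dy}{dt}-\mu' t\tfrac{dx}{dt}+\mathrm{res}\langle \tfrac{dx}{dt},y\rangle_t\,c,$$ where $\langle\,,\rangle_t$ is the $\mathcal K$-bilinear extension of the Killing form of $\mathfrak{sl}_n(\mathbb C)$ and $\mathrm{res}$ is the coefficient of $t^{-1}$. An element $X$ is nilpotent if $\mathrm{ad}X$ is a nilpotent endomorphism of $\hat{\mathfrak g}$. The group $\overline{\mathfrak L}(\mathrm{Sl}_n(\mathbb C))=\mathbb C^*\ltimes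 \mathrm{Sl}_n(\mathcal K)$ (where $z\in\mathbb C^*$ acts by $g(t)\mapsto g(zt)$; $d_z=(z,1)$) acts on $\hat{\mathfrak g}$ by: for $g\in\mathrm{Sl}_n(\mathcal K)$, $$\mathrm{Ad}\,g(x+\lambda c+\mu d)=gxg^{-1}-\mu t\tfrac{dg}{dt}g^{-1}+\Big(\lambda-\mathrm{res}\big\langle g^{-1}\tfrac{dg}{dt},\,x-\tfrac12\mu t g^{-1}\tfrac{dg}{dt}\big\rangle_t\Big)c+\mu d,$$ and $\mathrm{Ad}\,d_z(x(t)+\lambda c+\mu d)=x(zt)+\lambda c+\mu d$. For $\overline p=(p_1,\dots,p_{m-1})$ with $p_i\in\mathcal K\setminus\{0\}$, the quasi-Jordan block $J_{\overline p,m}$ is the $m\times m$ matrix over $\mathcal K$ whose $(i,i+1)$ entry is $p_i$ for $1\le i\le m-1$ and whose other entries are $0$. A quasi-Jordan matrix is a block diagonal matrix $D(J_{\overline p_1,i_1},\dots,J_{\overline p_d,i_d})$ with quasi-Jordan blocks of sizes $i_1\ge\dots\ge i_d\ge1$; here $i_1+\dots+i_d=n$. *)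

(* Defs.v *)
From HB Require Import structures.
From mathcomp Require Import all_boot all_order all_algebra.
From mathcomp Require Import perm.
From mathcomp Require Import boolp classical_sets functions cardinality fsbigop reals.
From mathcomp Require Import complex.
From mathcomp Require Import zify ring lra.

Set Implicit Arguments.
Unset Strict Implicit.
Unset Printing Implicit Defensive.

Import Order.TTheory GRing.Theory Num.Theory.
Local Open Scope classical_set_scope.
Local Open Scope ring_scope.

Section Laurent.
Variable F : fieldType.
Implicit Types (k a b : int) (m n : nat) (s : int -> F).

Definition vanishes_below s a := forall k, k < a -> s k = 0.

Record laurent := Laurent {
  lcoef :> int -> F;
  lcoef_bounded : exists a, vanishes_below lcoef a
}.
Implicit Types f g h : laurent.

Lemma laurentP f g : (f : int -> F) =1 g <-> f = g.
Proof.
split=> [|->//]; case: f g => [f bf] [g bg] /= /funext fg.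
by rewrite fg in bf *; congr Laurent; exact: Prop_irrelevance.
Qed.

HB.instance Definition _ := gen_eqMixin laurent.
HB.instance Definition _ := gen_choiceMixin laurent.

Lemma vanishes_below_le s a b :
  b <= a -> vanishes_below s a -> vanishes_below s b.
Proof. by move=> ba sa k kb; apply: sa; lia. Qed.

Lemma common_bound f g :
  exists2 a, vanishes_below f a & vanishes_below g a.
Proof.
have [a fa] := lcoef_bounded f; have [b gb] := lcoef_bounded g.
by exists (Num.min a b);
  [apply: vanishes_below_le fa | apply: vanishes_below_le gb]; lia.
Qed.

Lemma bounded0 : exists a, vanishes_below (fun=> 0) a. Proof. by exists 0. Qed.

Lemma bounded_opp f : exists a, vanishes_below (fun k => - f k) a.
Proof.
by have [a fa] := lcoef_bounded f; exists a => k /fa ->; rewrite oppr0.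
Qed.

Lemma bounded_add f g : exists a, vanishes_below (fun k => f k + g k) a.
Proof.
have [a fa ga] := common_bound f g.
by exists a => k ka; rewrite fa// ga// addr0.
Qed.

Definition laurent_zero := Laurent bounded0.
Definition laurent_opp f := Laurent (bounded_opp f).
Definition laurent_add f g := Laurent (bounded_add f g).

Fact laurent_addA : associative laurent_add.
Proof. by move=> f g h; apply/laurentP => k /=; rewrite addrA. Qed.
Fact laurent_addC : commutative laurent_add.
Proof. by move=> f g; apply/laurentP => k /=; rewrite addrC. Qed.
Fact laurent_add0 : left_id laurent_zero laurent_add.
Proof. by move=> f; apply/laurentP => k /=; rewrite add0r. Qed.
Fact laurent_addN : left_inverse laurent_zero laurent_opp laurent_add.
Proof. by move=> f; apply/laurentP => k /=; rewrite addNr. Qed.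

HB.instance Definition _ := GRing.isZmodule.Build laurent
  laurent_addA laurent_addC laurent_add0 laurent_addN.

(* The sum has finite support, because f and g vanish below some index. *)
Definition conv s s' k : F := \sum_(i \in [set: int]) s i * s' (k - i).

Lemma convE s s' a b n : vanishes_below s a -> vanishes_below s' b ->
  conv s s' (a + b + n%:Z) = \sum_(i < n.+1) s (a + i%:Z) * s' (b + (n - i)%N%:Z).
Proof.
move=> sa sb; rewrite /conv.
pose r : seq int := [seq a + m%:Z | m <- iota 0 n.+1].
rewrite -(@fsbig_widen _ _ _ _ [set` r]) //; last first.
  move=> j [_ /= jr].
  have [ja|aj] := ltP j a; first by rewrite sa// mul0r.
  rewrite [s' _]sb ?mulr0//.
  rewrite ltNge; apply/negP => h; apply: jr; apply/mapP.
  by exists `|j - a|%N; [rewrite mem_iota; lia | lia].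
rewrite -fsbig_seq; last by rewrite map_inj_uniq ?iota_uniq// => x y; lia.
rewrite big_map -[iota 0 n.+1]/(index_iota 0 n.+1) big_mkord.
apply: eq_bigr => i _; congr (_ * s' _).
by have := ltn_ord i; lia.
Qed.

Lemma conv_below s s' a b :
  vanishes_below s a -> vanishes_below s' b -> vanishes_below (conv s s') (a + b).
Proof.
move=> sa sb k kab; rewrite /conv fsbig1// => i _.
have [ia|ai] := ltP i a; first by rewrite sa// mul0r.
by rewrite [s' _]sb ?mulr0//; lia.
Qed.

Lemma bounded_mul f g : exists a, vanishes_below (conv f g) a.
Proof.
have [a fa] := lcoef_bounded f; have [b gb] := lcoef_bounded g.
by exists (a + b); exact: conv_below.
Qed.

Lemma bounded_monomial (c : F) a :
  exists b, vanishes_below (fun k => if k == a then c else 0) b.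
Proof. by exists a => k ka; rewrite lt_eqF. Qed.

Definition laurent_mul f g := Laurent (bounded_mul f g).
Definition monomial (c : F) a := Laurent (bounded_monomial c a).

Definition trunc s a n : {poly F} := \poly_(i < n) s (a + i%:Z).

Lemma conv_trunc s s' a b n m : vanishes_below s a -> vanishes_below s' b ->
  (m < n)%N -> conv s s' (a + b + m%:Z) = (trunc s a n * trunc s' b n)`_m.
Proof.
move=> sa sb mn; rewrite (convE _ sa sb) coefM; apply: eq_bigr => i _.
by rewrite !coef_poly ifT ?ifT//; have := ltn_ord i; lia.
Qed.

Lemma coefM_eq (p p' q q' : {poly F}) m :
  (forall i, (i <= m)%N -> p`_i = p'`_i) ->
  (forall i, (i <= m)%N -> q`_i = q'`_i) -> (p * q)`_m = (p' * q')`_m.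
Proof.
move=> pp qq; rewrite !coefM; apply: eq_bigr => i _.
by rewrite pp ?qq//; have := ltn_ord i; lia.
Qed.

Lemma le_natE a k : a <= k -> exists n, k = a + n%:Z.
Proof. by move=> ak; exists `|k - a|%N; lia. Qed.

Fact laurent_mulC : commutative laurent_mul.
Proof.
move=> f g; apply/laurentP => k /=.
have [a fa ga] := common_bound f g.
have [ka|/le_natE[n ->]] := ltP k (a + a); first by rewrite !(@conv_below _ _ a a).
by rewrite !(@conv_trunc _ _ _ _ n.+1)// mulrC.
Qed.

Fact laurent_mulA : associative laurent_mul.
Proof.
move=> f g h; apply/laurentP => k /=.
have [a fa] := lcoef_bounded f; have [b gb] := lcoef_bounded g.
have [c hc] := lcoef_bounded h.
have fgab := conv_below fa gb; have ghbc := conv_below gb hc.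
have [ka|/le_natE[n ->]] := ltP k (a + (b + c)).
  by rewrite (conv_below fa ghbc)// (conv_below fgab hc)//; lia.
rewrite (@conv_trunc _ _ _ _ n.+1)// addrA (@conv_trunc _ _ _ _ n.+1)//.
rewrite (@coefM_eq _ (trunc f a n.+1) _ (trunc g b n.+1 * trunc h c n.+1))//.
  rewrite mulrA; apply: coefM_eq => // i im.
  by rewrite coef_poly ltnS im (@conv_trunc _ _ _ _ n.+1).
by move=> i im; rewrite coef_poly ltnS im (@conv_trunc _ _ _ _ n.+1).
Qed.

Fact laurent_mul1 : left_id (monomial 1 0) laurent_mul.
Proof.
move=> f; apply/laurentP => k /=; rewrite /conv.
rewrite -(@fsbig_widen _ _ _ _ [set 0])//; last first.
  by move=> i [_ /= /eqP/negbTE i0]; rewrite i0 mul0r.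
by rewrite fsbig_set1 eqxx mul1r subr0.
Qed.

Fact laurent_mulDl : left_distributive laurent_mul +%R.
Proof.
move=> f g h; apply/laurentP => k /=.
have [a fa ga] := common_bound f g; have [b hb] := lcoef_bounded h.
have fga : vanishes_below (f + g) a by move=> i ia /=; rewrite fa// ga// addr0.
have [ka|/le_natE[n ->]] := ltP k (a + b).
  by rewrite !(conv_below _ hb ka)// addr0.
rewrite !(convE _ _ hb)// -big_split.
by apply: eq_bigr => i _; rewrite mulrDl.
Qed.

Fact laurent_one_neq0 : monomial 1 0 != 0.
Proof.
by apply/eqP => /laurentP/(_ 0)/=/eqP; rewrite oner_eq0.
Qed.

HB.instance Definition _ := GRing.Zmodule_isComNzRing.Build laurent
  laurent_mulA laurent_mulC laurent_mul1 laurent_mulDl laurent_one_neq0.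

Fixpoint psinv_seq (u : nat -> F) n : seq F :=
  if n is n'.+1 then
    let s := psinv_seq u n' in
    rcons s (((n' == 0%N)%:R - \sum_(i < n') s`_i * u (n' - i)%N) / u 0%N)
  else [::].

Lemma size_psinv_seq u n : size (psinv_seq u n) = n.
Proof. by elim: n => //= n IH; rewrite size_rcons IH. Qed.

Lemma nth_psinv_seq u n i : (i < n)%N ->
  (psinv_seq u n)`_i = (psinv_seq u i.+1)`_i.
Proof.
elim: n => // n IH; rewrite ltnS leq_eqVlt => /predU1P[->//|ni] /=.
by rewrite nth_rcons size_psinv_seq ni IH.
Qed.

Lemma psinvP (u : nat -> F) n : u 0%N != 0 ->
  \sum_(i < n.+1) (psinv_seq u i.+1)`_i * u (n - i)%N = (n == 0%N)%:R.
Proof.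
move=> u0; rewrite big_ord_recr /= subnn nth_rcons size_psinv_seq ltnn eqxx.
rewrite divfK//; under eq_bigr => i _.
  rewrite -[rcons _ _]/(psinv_seq u i.+1) -(@nth_psinv_seq _ n)//.
over.
by rewrite addrC subrK.
Qed.

Lemma laurent_inv_ex f : f != 0 -> exists g, g * f = 1.
Proof.
move=> f0; have [a fa] := lcoef_bounded f.
have ex : exists n, f (a + n%:Z) != 0.
  apply/not_existsP => fn; case/eqP: f0; apply/laurentP => k /=.
  have [/fa//|/le_natE[n ->]] := ltP k a.
  by apply/eqP/negP => /negP; exact: fn.
case: (ex_minnP ex) => v fv vmin.
set b : int := a + v%:Z in fv.
have fb : vanishes_below f b.
  move=> k kb; have [/fa//|/le_natE[n kn]] := ltP k a.
  rewrite kn; apply/eqP/negP => /negP/vmin; rewrite /b in kb; lia.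
pose u m := f (b + m%:Z).
have u0 : u 0%N != 0 by rewrite /u addr0.
pose w k := if 0 <= b + k then (psinv_seq u (absz (b + k)).+1)`_(absz (b + k)) else 0.
have wb : vanishes_below w (- b) by move=> k kb; rewrite /w ifN//; lia.
exists (Laurent (ex_intro _ _ wb)); apply/laurentP => k /=.
have [k0|/le_natE[n kn]] := ltP k (- b + b).
  by rewrite (conv_below wb fb)// ifN//; lia.
rewrite kn (convE n wb fb) addNr add0r (eq_bigr (fun i : 'I_n.+1 =>
  (psinv_seq u i.+1)`_i * u (n - i)%N)) ?psinvP //; first by case: n kn.
move=> i _; rewrite /w addrA subrr add0r /=.
by [].
Qed.

Definition laurent_inv f : laurent := xget 0 [set g | g * f = 1].

Fact laurent_mulVf f : f != 0 -> laurent_inv f * f = 1.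
Proof. by move=> /laurent_inv_ex; rewrite /laurent_inv => /xgetPex. Qed.

Fact laurent_inv0 : laurent_inv 0 = 0.
Proof.
rewrite /laurent_inv; case: xgetP => // g _ /eqP.
by rewrite mulr0 eq_sym oner_eq0.
Qed.

HB.instance Definition _ := GRing.ComNzRing_isField.Build laurent
  laurent_mulVf laurent_inv0.

End Laurent.

Section Calculus.
Variable F : fieldType.
Implicit Types (f g : laurent F) (z c : F).

Definition residue f : F := f (-1).

Definition laurent_t : laurent F := monomial 1 1.

Definition laurent_const c : laurent F := monomial c 0.

Lemma bounded_deriv f :
  exists a, vanishes_below (fun k => f (k + 1) *~ (k + 1)) a.
Proof.
have [a fa] := lcoef_bounded f; exists (a - 1) => k ka.
by rewrite fa ?mul0rz//; lia.
Qed.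

Definition laurent_deriv f := Laurent (bounded_deriv f).

Lemma bounded_rescale z f : exists a, vanishes_below (fun k => f k * z ^ k) a.
Proof.
by have [a fa] := lcoef_bounded f; exists a => k ka; rewrite fa// mul0r.
Qed.

(* f(t) |-> f(z t) *)
Definition rescale z f := Laurent (bounded_rescale z f).

Definition is_laurent_polynomial f := exists b, forall k, b < k -> f k = 0.

Lemma laurent_derivM f g :
  laurent_deriv (f * g) = laurent_deriv f * g + f * laurent_deriv g.
Proof.
apply/laurentP => k /=.
have [a fa] := lcoef_bounded f; have [b gb] := lcoef_bounded g.
have fa' : vanishes_below (laurent_deriv f) (a - 1).
  by move=> j ja /=; rewrite fa ?mul0rz//; lia.
have gb' : vanishes_below (laurent_deriv g) (b - 1).
  by move=> j jb /=; rewrite gb ?mul0rz//; lia.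
have [kab|/le_natE[n kn]] := ltP (k + 1) (a + b).
  rewrite (conv_below fa gb)// (conv_below fa' gb); last lia.
  by rewrite (conv_below fa gb') ?mul0rz ?addr0//; lia.
have k1 : k = a - 1 + b + n%:Z by lia.
have k2 : k = a + (b - 1) + n%:Z by lia.
rewrite kn (convE n fa gb) {1}k1 (convE n fa' gb) k2 (convE n fa gb').
rewrite mulrz_suml -big_split/=; apply: eq_bigr => i _.
rewrite (_ : a - 1 + i%:Z + 1 = a + i%:Z); last lia.
rewrite (_ : b - 1 + (n - i)%N%:Z + 1 = b + (n - i)%N%:Z); last lia.
rewrite mulrzAl mulrzAr -mulrzDr; congr (_ *~ _).
by have := ltn_ord i; lia.
Qed.

Fact laurent_deriv_is_zmod_morphism : zmod_morphism laurent_deriv.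
Proof. by move=> f g; apply/laurentP => k /=; rewrite mulrzBl. Qed.
HB.instance Definition _ := GRing.isZmodMorphism.Build _ _ laurent_deriv
  laurent_deriv_is_zmod_morphism.

Lemma laurent_deriv1 : laurent_deriv 1 = 0.
Proof.
apply/laurentP => k /=; case: eqP => [->|_]; first by rewrite mulr0z.
by rewrite mul0rz.
Qed.

Fact laurent_const_is_zmod_morphism : zmod_morphism laurent_const.
Proof.
by move=> c c'; apply/laurentP => k /=; case: eqP => // _; rewrite subr0.
Qed.
HB.instance Definition _ := GRing.isZmodMorphism.Build _ _ laurent_const
  laurent_const_is_zmod_morphism.

Fact laurent_const_is_monoid_morphism : monoid_morphism laurent_const.
Proof.
split=> // c c'; apply/laurentP => k /=.
rewrite -[LHS]/(monomial (c * c') 0 k).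
have c0 e : vanishes_below (monomial (e : F) 0) 0.
  by move=> j j0 /=; rewrite lt_eqF.
have [k0|/le_natE[n ->]] := ltP k (0 + 0).
  by rewrite (conv_below (c0 c) (c0 c')) ?c0.
rewrite (convE n (c0 c) (c0 c')) big_ord_recl/= subn0 add0r big1 ?addr0 => [|i _].
  by case: n => [|n] //; rewrite mulr0.
by rewrite mul0r.
Qed.
HB.instance Definition _ := GRing.isMonoidMorphism.Build _ _ laurent_const
  laurent_const_is_monoid_morphism.

Lemma rescaleD z : {morph rescale z : f g / f + g}.
Proof. by move=> f g; apply/laurentP => k /=; rewrite mulrDl. Qed.

Lemma rescaleB z : {morph rescale z : f g / f - g}.
Proof. by move=> f g; apply/laurentP => k /=; rewrite mulrDl mulNr. Qed.

Lemma rescale1 z : rescale z 1 = 1.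
Proof.
apply/laurentP => k /=; case: eqP => [->|_]; last by rewrite mul0r.
by rewrite mul1r.
Qed.

Lemma rescaleM z : z != 0 -> {morph rescale z : f g / f * g}.
Proof.
move=> z0 f g; apply/laurentP => k /=.
have [a fa] := lcoef_bounded f; have [b gb] := lcoef_bounded g.
have fa' : vanishes_below (rescale z f) a by move=> j /fa /= ->; rewrite mul0r.
have gb' : vanishes_below (rescale z g) b by move=> j /gb /= ->; rewrite mul0r.
have [kab|/le_natE[n ->]] := ltP k (a + b).
  by rewrite (conv_below fa gb)// (conv_below fa' gb')// mul0r.
rewrite !convE// mulr_suml; apply: eq_bigr => i _ /=.
rewrite mulrACA -expfzDr//; congr (_ * z ^ _).
by have := ltn_ord i; lia.
Qed.

Lemma rescale_rmorphism z : z != 0 ->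
  exists phi : {rmorphism laurent F -> laurent F}, phi = rescale z :> (_ -> _).
Proof.
move=> z0.
pose za := GRing.isZmodMorphism.Build _ _ (rescale z) (rescaleB z).
pose zm := GRing.isMonoidMorphism.Build _ _ (rescale z)
  (conj (rescale1 z) (rescaleM z0)).
pose phi : {rmorphism laurent F -> laurent F} := HB.pack (rescale z) za zm.
by exists phi.
Qed.

Lemma rescale_id f : rescale 1 f = f.
Proof. by apply/laurentP => k /=; rewrite exp1rz mulr1. Qed.

Lemma rescale_comp z z' f : rescale z (rescale z' f) = rescale (z * z') f.
Proof.
by apply/laurentP => k /=; rewrite expfzMl -mulrA [z' ^ _ * _]mulrC.
Qed.

End Calculus.

Definition linear_of (F : fieldType) (U V : lmodType F) (phi : U -> V)
    (lin : linear phi) : {linear U -> V} :=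
  HB.pack phi (GRing.isLinear.Build F U V *:%R phi lin).

Section SpecialLinear.
Variables (F : fieldType) (n : nat).
Implicit Types A B x y : 'M[F]_n.

Definition sl : {vspace 'M[F]_n} := lker (linfun (@mxtrace F n : _ -> F^o)).

Lemma slE A : (A \in sl) = (\tr A == 0).
Proof. by rewrite memv_ker lfunE. Qed.

Definition lie A B := A *m B - B *m A.

Lemma lie_sl A B : lie A B \in sl.
Proof. by rewrite slE linearB/= mxtrace_mulC subrr. Qed.

(* The trace of ad x \o ad y as an endomorphism of sl, computed in a basis of
   sl. The formula makes sense for all matrices x and y, since [gl, gl] is
   included in sl; it is the Killing form of sl when x and y are in sl. *)
Definition killing x y : F :=
  \sum_i coord (vbasis sl) i (lie x (lie y (vbasis sl)`_i)).

Lemma lie_is_linear A : linear (lie A).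
Proof.
move=> c x y; rewrite /lie linearP/= mulmxDl -scalemxAl opprD scalerBr.
by rewrite addrACA.
Qed.

Lemma lieDl A A' B : lie (A + A') B = lie A B + lie A' B.
Proof. by rewrite /lie mulmxDl mulmxDr opprD addrACA. Qed.

Lemma lieZl c A B : lie (c *: A) B = c *: lie A B.
Proof. by rewrite /lie -scalemxAl -scalemxAr scalerBr. Qed.

Lemma lieDr A B B' : lie A (B + B') = lie A B + lie A B'.
Proof. by rewrite /lie mulmxDl mulmxDr opprD addrACA. Qed.

Lemma lieZr c A B : lie A (c *: B) = c *: lie A B.
Proof. by rewrite /lie -scalemxAl -scalemxAr scalerBr. Qed.

Lemma killing_linearl y : linear (killing^~ y : _ -> F^o).
Proof.
move=> c x x'; rewrite /killing scaler_sumr -big_split; apply: eq_bigr => i _.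
by rewrite lieDl lieZl linearP.
Qed.

Lemma killing_linearr x : linear (killing x : _ -> F^o).
Proof.
move=> c y y'; rewrite /killing scaler_sumr -big_split; apply: eq_bigr => i _.
by rewrite lieDl lieZl lieDr lieZr linearP.
Qed.

End SpecialLinear.

Section Affine.
Variables (F : fieldType) (n : nat).
Local Notation K := (laurent F).
Implicit Types (x y g : 'M[K]_n).

Definition dt x : 'M[K]_n := map_mx (@laurent_deriv F) x.

(* x and y are expanded on the elementary matrices. This is the only K-bilinear
   map that agrees with [killing] on matrices with constant entries
   (see killing_t_const). *)
Definition killing_t x y : K :=
  \sum_i \sum_j \sum_k \sum_l
    x i j * y k l * laurent_const (killing (delta_mx i j) (delta_mx k l)).

(* x + lambda c + mu d is the triple (x, lambda, mu). No condition is put on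
   the trace of x here; the algebra itself is affine_completed below. *)
Definition affine : Type := ('M[K]_n * F * F)%type.
Implicit Types X Y : affine.

Definition affine_completed : set affine := [set X | X.1.1 \in sl K n].

Definition affine_poly : set affine :=
  [set X | affine_completed X /\ forall i j, is_laurent_polynomial (X.1.1 i j)].

Definition bracket X Y : affine :=
  let: (x, lambda, mu) := X in
  let: (y, lambda', mu') := Y in
  (lie x y + (laurent_const mu * laurent_t F) *: dt y
     - (laurent_const mu' * laurent_t F) *: dt x,
   residue (killing_t (dt x) y),
   0).

Definition ad_nilpotent X :=
  exists k, forall Y, affine_completed Y -> iter k (bracket X) Y = 0.

Record loop_group := LoopGroup {
  loop_rot : F;
  loop_mx : 'M[K]_n;
  loop_rot_neq0 : loop_rot != 0;
  loop_det : \det loop_mx = 1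
}.

Definition Ad_mx g X : affine :=
  let: (x, lambda, mu) := X in
  let w := invmx g *m dt g in
  (g *m x *m invmx g - (laurent_const mu * laurent_t F) *: (dt g *m invmx g),
   lambda - residue (killing_t w
     (x - (laurent_const (2^-1 * mu) * laurent_t F) *: w)),
   mu).

Definition Ad_rot (z : F) X : affine :=
  let: (x, lambda, mu) := X in (map_mx (rescale z) x, lambda, mu).

(* (z, g) is the product g d_z; see loop_mul for the matching group law. *)
Definition Ad (h : loop_group) X : affine :=
  Ad_mx (loop_mx h) (Ad_rot (loop_rot h) X).


Lemma killing_t_linearl y : linear (killing_t^~ y : _ -> K^o).
Proof.
move=> c x x'; rewrite /killing_t.
do 4![rewrite scaler_sumr -big_split; apply: eq_bigr => ? _].
by rewrite !mxE !mulrDl -!mulrA.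
Qed.

Lemma killing_t_linearr x : linear (killing_t x : _ -> K^o).
Proof.
move=> c y y'; rewrite /killing_t.
do 4![rewrite scaler_sumr -big_split; apply: eq_bigr => ? _].
by rewrite !mxE mulrDr mulrDl mulrCA -!mulrA.
Qed.

Lemma killing_t_const (x y : 'M[F]_n) :
  killing_t (map_mx (@laurent_const F) x) (map_mx (@laurent_const F) y)
  = laurent_const (killing x y).
Proof.
have kZl a A B : killing (a *: A) B = a * killing A B.
  exact: linearZ_LR (linear_of (killing_linearl B)) a A.
have kZr a A B : killing A (a *: B) = a * killing A B.
  exact: linearZ_LR (linear_of (killing_linearr A)) a B.
have kSl (A : 'I_n -> 'M[F]_n) B :
    killing (\sum_i A i) B = \sum_i killing (A i) B.
  exact: (raddf_sum (linear_of (killing_linearl B))).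
have kSr (A : 'I_n -> 'M[F]_n) B :
    killing B (\sum_i A i) = \sum_i killing B (A i).
  exact: (raddf_sum (linear_of (killing_linearr B))).
rewrite [in RHS](matrix_sum_delta x).
rewrite kSl raddf_sum.
apply: eq_bigr => i _.
rewrite kSl raddf_sum.
apply: eq_bigr => j _ /=.
rewrite [in RHS](matrix_sum_delta y).
rewrite kSr raddf_sum.
apply: eq_bigr => k _.
rewrite kSr raddf_sum.
apply: eq_bigr => l _ /=.
by rewrite kZl kZr !mxE !rmorphM mulrA.
Qed.

Lemma bracket_completed X Y :
  affine_completed X -> affine_completed Y -> affine_completed (bracket X Y).
Proof.
have dt_sl x : x \in sl K n -> dt x \in sl K n.
  rewrite !slE => /eqP x0; rewrite /mxtrace.
  under eq_bigr => i _ do rewrite mxE.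
  by rewrite -raddf_sum -/(mxtrace x) x0 raddf0.
case: X Y => [[x la] mu] [[y la'] mu']; rewrite /affine_completed/= => sx sy.
apply: rpredB; last by apply: rpredZ; exact: dt_sl.
by apply: rpredD; [exact: lie_sl | apply: rpredZ; exact: dt_sl].
Qed.

Lemma laurent_deriv_prod (I : finType) (f : I -> K) :
  laurent_deriv (\prod_i f i) =
  \sum_i laurent_deriv (f i) * \prod_(j | i != j) f j.
Proof.
have H (s : seq I) : uniq s -> laurent_deriv (\prod_(i <- s) f i) =
    \sum_(i <- s) laurent_deriv (f i) * \prod_(j <- s | i != j) f j.
  elim: s => [|i s IH] /=; first by rewrite !big_nil laurent_deriv1.
  move=> /andP[si us]; rewrite !big_cons laurent_derivM IH// eqxx mulr_sumr.
  congr (_ * _ + _).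
    rewrite big_seq_cond [RHS]big_seq_cond; apply: eq_bigl => j.
    by case: eqVneq => [<-|_]; rewrite ?(negbTE si) ?andbT.
  rewrite big_seq [RHS]big_seq; apply: eq_bigr => j js; rewrite big_cons ifT.
    by rewrite mulrCA.
  by apply: contraNneq si => <-.
exact: (H _ (index_enum_uniq I)).
Qed.

Lemma laurent_deriv_det g : laurent_deriv (\det g) = \tr (dt g *m \adj g).
Proof.
rewrite /determinant raddf_sum/=.
under eq_bigr => s _.
  have -> : laurent_deriv ((-1) ^+ s * \prod_i g i (s i)) =
      (-1) ^+ s * laurent_deriv (\prod_i g i (s i)).
    by case: (s : bool); rewrite ?expr1 ?expr0 ?mulN1r ?mul1r// raddfN.
  rewrite laurent_deriv_prod mulr_sumr.
over.
rewrite exchange_big/=; apply: eq_bigr => i _; rewrite mxE.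
rewrite (partition_big (fun s : 'S_n => s i) predT)//=.
apply: eq_bigr => j _; rewrite !mxE expand_cofactor mulr_sumr.
by apply: eq_bigr => s /eqP <-; rewrite mulrCA.
Qed.

Lemma tr_dtV g : \det g = 1 -> \tr (dt g *m invmx g) = 0.
Proof.
move=> g1; have := laurent_deriv_det g; rewrite g1 laurent_deriv1 /invmx.
by rewrite unitmxE g1 unitr1 invr1 scale1r.
Qed.

Lemma Ad_completed h X : affine_completed X -> affine_completed (Ad h X).
Proof.
case: X => [[x la] mu]; rewrite /affine_completed/= !slE => /eqP x0.
have g1 := loop_det h; set g := loop_mx h in g1 *.
have gu : g \in unitmx by rewrite unitmxE g1 unitr1.
rewrite linearB/= linearZ/= tr_dtV// mulr0 subr0 mxtrace_mulC mulKmx//.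
have [phi phiE] := rescale_rmorphism (loop_rot_neq0 h).
by rewrite -phiE trace_map_mx x0 rmorph0.
Qed.

Lemma det_rescale z g : z != 0 -> \det g = 1 ->
  \det (map_mx (rescale z) g) = 1.
Proof.
by move=> /rescale_rmorphism[phi <-] g1; rewrite det_map_mx g1 rmorph1.
Qed.

Fact loop_one_det : \det (1%:M : 'M[K]_n) = 1. Proof. exact: det1. Qed.
Definition loop_one := LoopGroup (oner_neq0 F) loop_one_det.

Fact loop_mul_det (h h' : loop_group) :
  \det (loop_mx h *m map_mx (rescale (loop_rot h)) (loop_mx h')) = 1.
Proof.
by rewrite det_mulmx loop_det det_rescale ?mulr1 ?loop_rot_neq0 ?loop_det.
Qed.

(* Semidirect product law in which d_z g d_z^-1 is g(z t). *)
Definition loop_mul (h h' : loop_group) :=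
  LoopGroup (mulf_neq0 (loop_rot_neq0 h) (loop_rot_neq0 h')) (loop_mul_det h h').

Fact loop_inv_rot (h : loop_group) : (loop_rot h)^-1 != 0.
Proof. by rewrite invr_neq0 ?loop_rot_neq0. Qed.
Fact loop_inv_det (h : loop_group) :
  \det (map_mx (rescale (loop_rot h)^-1) (invmx (loop_mx h))) = 1.
Proof. by rewrite det_rescale ?loop_inv_rot// det_inv loop_det invr1. Qed.
Definition loop_inv (h : loop_group) :=
  LoopGroup (loop_inv_rot h) (loop_inv_det h).

HB.instance Definition _ := gen_eqMixin loop_group.
HB.instance Definition _ := gen_choiceMixin loop_group.

Lemma loop_groupP (h h' : loop_group) :
  loop_rot h = loop_rot h' -> loop_mx h = loop_mx h' -> h = h'.
Proof.
case: h h' => [z g z0 g1] [z' g' z0' g1'] /= zz gg.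
by subst; congr LoopGroup; exact: Prop_irrelevance.
Qed.

Lemma map_rescale_comp (z z' : F) g :
  map_mx (rescale z) (map_mx (rescale z') g) = map_mx (rescale (z * z')) g.
Proof. by apply/matrixP => i j; rewrite !mxE rescale_comp. Qed.

Lemma map_rescale_id g : map_mx (rescale 1) g = g.
Proof. by apply/matrixP => i j; rewrite !mxE rescale_id. Qed.

Lemma map_rescaleM (z : F) g g' : z != 0 ->
  map_mx (rescale z) (g *m g') = map_mx (rescale z) g *m map_mx (rescale z) g'.
Proof. by move=> /rescale_rmorphism[phi <-]; rewrite map_mxM. Qed.

Lemma map_rescale1 (z : F) : z != 0 -> map_mx (rescale z) 1%:M = 1%:M :> 'M_n.
Proof. by move=> /rescale_rmorphism[phi <-]; rewrite map_mx1. Qed.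

Lemma loop_mx_unit (h : loop_group) : loop_mx h \in unitmx.
Proof. by rewrite unitmxE loop_det unitr1. Qed.

Fact loop_mulA : associative loop_mul.
Proof.
move=> h1 h2 h3; apply: loop_groupP => /=; first by rewrite mulrA.
by rewrite map_rescaleM ?loop_rot_neq0// map_rescale_comp mulmxA.
Qed.

Fact loop_mul1 : left_id loop_one loop_mul.
Proof.
by move=> h; apply: loop_groupP; rewrite /= ?mul1r// mul1mx map_rescale_id.
Qed.

Fact loop_mulr1 : right_id loop_one loop_mul.
Proof.
move=> h; apply: loop_groupP; rewrite /= ?mulr1//.
by rewrite map_rescale1 ?loop_rot_neq0// mulmx1.
Qed.

Fact loop_mulV : left_inverse loop_one loop_inv loop_mul.
Proof.
move=> h; apply: loop_groupP; rewrite /= ?mulVf ?loop_rot_neq0//.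
rewrite -map_rescaleM ?loop_inv_rot// mulVmx ?loop_mx_unit//.
by rewrite map_rescale1 ?loop_inv_rot.
Qed.

Fact loop_mulrV : right_inverse loop_one loop_inv loop_mul.
Proof.
move=> h; apply: loop_groupP; rewrite /= ?mulfV ?loop_rot_neq0//.
rewrite map_rescale_comp mulfV ?loop_rot_neq0// map_rescale_id.
by rewrite mulmxV ?loop_mx_unit.
Qed.

HB.instance Definition _ := isGroup.Build loop_group
  loop_mulA loop_mul1 loop_mulr1 loop_mulV loop_mulrV.

End Affine.

Section QuasiJordan.
Variable K : fieldType.

Definition quasi_jordan_block m (p : m.-1.-tuple K) : 'M[K]_m :=
  \matrix_(i, j) if j == i.+1 :> nat then p`_i else 0.

Definition quasi_jordan d (s : 'I_d -> nat) (p : forall k, (s k).-1.-tuple K) :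
  'M[K]_(\sum_k s k) := \mxdiag_k quasi_jordan_block (p k).

End QuasiJordan.

(* Main.v *)
Require Import Defs.
From mathcomp Require Import all_boot all_order all_algebra.
From mathcomp Require Import fieldext.
From mathcomp Require Import boolp zify.
From mathcomp Require Import reals complex.

Set Implicit Arguments.
Unset Strict Implicit.

Import GRing.Theory Num.Theory.
Local Open Scope ring_scope.

(** Write [X = x + lambda c + mu d]. The matrix part of [ad X] is the operator
    [D = ad x + mu t d/dt] on [sl_n(K)], and it is nilpotent.

    The degree [mu] vanishes ([derivation_nilpotent_degree0]). Some nonzero [y]
    has [D y = 0], and then [t y] is an eigenvector: [D (t y) = mu t y]. A
    nilpotent operator only has the eigenvalue 0.

    Hence [ad x] is nilpotent, and [x] itself is nilpotent because its trace is
    zero ([lie_nilpotent_traceless]). Over a finite extension of K the matrix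
    [x] has an eigenvalue [z], with row eigenvector [v]. On rank one matrices
    [w v] the operator [ad x] is [w |-> (x - z) w], so [x - z] is nilpotent. Its
    trace [- n z] is zero, and [z = 0] in characteristic 0.

    A nilpotent matrix over any field has a basis made of chains
    [v, v x, v x^2, ...] of weakly decreasing lengths ([chain_basis]). In such a basis
    [x] is block diagonal with Jordan blocks. Rescaling one basis vector gives
    the change of basis any prescribed nonzero determinant, in particular 1, at
    the price of replacing at most one superdiagonal 1 by another nonzero
    element of the field ([nilpotent_quasi_jordan]); this is where quasi-Jordan
    blocks come from. For [mu = 0] the action of [g] on the matrix part is conjugation, and
    [d_z] with [z = 1] acts trivially. *)

(** * Chain bases of a nilpotent matrix *)

Section Chains.
Variables (F : fieldType) (n : nat) (x : 'M[F]_n).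
Implicit Types (U : 'M[F]_n) (v : 'rV[F]_n).

Definition chain v s : 'M[F]_(s, n) := \matrix_(j < s) (v *m x ^+ j).

Lemma stable_pow U j : (U *m x <= U)%MS -> (U *m x ^+ j <= U)%MS.
Proof.
move=> Ux; elim: j => [|j IH]; first by rewrite expr0 mulmx1.
by rewrite exprSr -mulmxE mulmxA (submx_trans _ Ux) ?submxMr.
Qed.

Lemma pow_vanish m (W : 'M[F]_(m, n)) i j :
  (i <= j)%N -> W *m x ^+ i = 0 -> W *m x ^+ j = 0.
Proof. by move=> ij W0; rewrite -(subnKC ij) exprD -mulmxE mulmxA W0 mul0mx. Qed.

(** A vector [v] of maximal height spans a chain that has a stable complement.
    Choose a coordinate [k] with [(v x^s)_k <> 0]; the complement is the set of
    the [u] in [U] such that [(u x^i)_k = 0] for all [i <= s], which is stable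
    as [x^(s+1)] vanishes on [U]. The pairing between the chain and these
    linear forms is triangular with [(v x^s)_k] on the diagonal, hence
    perfect. *)
Lemma chain_complement U v s :
    (U *m x <= U)%MS -> U *m x ^+ s.+1 = 0 -> (v <= U)%MS -> v *m x ^+ s != 0 ->
  exists U' : 'M[F]_n, [/\ (U' <= U)%MS, (U' *m x <= U')%MS,
    \rank U = (s.+1 + \rank U')%N & (U <= chain v s.+1 + U')%MS].
Proof.
move=> Ux Us vU /rV0Pn[k vk].
have vs : v *m x ^+ s.+1 = 0.
  by case/submxP: vU => D ->; rewrite -mulmxA Us mulmx0.
(* The forms are listed by decreasing power of [x], so that [C *m B] is
   triangular and not antitriangular. *)
pose B : 'M[F]_(n, s.+1) := \matrix_(i, j) (x ^+ (s - j)) i k.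
have mulB m (W : 'M[F]_(m, n)) i j : (W *m B) i j = (W *m x ^+ (s - j)) i k.
  by rewrite !mxE; apply: eq_bigr => l _; rewrite mxE.
set C := chain v s.+1.
have CU : (C <= U)%MS.
  apply/row_subP => i; rewrite rowK.
  by rewrite (submx_trans _ (stable_pow i Ux)) ?submxMr.
have CBe (i j : 'I_s.+1) : (C *m B) i j = (v *m x ^+ (i + (s - j))) 0 k.
  transitivity (row i (C *m x ^+ (s - j)) 0 k); first by rewrite mulB [RHS]mxE.
  by rewrite row_mul rowK exprD -mulmxE mulmxA.
have CBu : C *m B \in unitmx.
  rewrite -unitmx_tr unitmxE det_trig; last first.
    apply/is_trig_mxP => i j ij; rewrite mxE CBe.
    by rewrite (pow_vanish _ vs) ?mxE// addnBA ?ltn_subRL; have := ltn_ord i; lia.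
  rewrite unitfE; apply/prodf_neq0 => i _.
  by rewrite mxE CBe subnKC// -ltnS ltn_ord.
have UB : \rank (U *m B) = s.+1.
  apply/eqP; rewrite eqn_leq rank_leq_col -[X in (X <= _)%N](mxrank_unit CBu).
  exact/mxrankS/submxMr.
pose W : 'M[F]_n := (U :&: kermx B)%MS.
have WU : (W <= U)%MS := capmxSl _ _.
exists W; split=> //.
- rewrite sub_capmx (submx_trans (submxMr x WU) Ux) /=.
  have /sub_kermxP/matrixP WB : (W <= kermx B)%MS := capmxSr _ _.
  have Ws : W *m x ^+ s.+1 = 0 by case/submxP: WU => D ->; rewrite -mulmxA Us mulmx0.
  apply/sub_kermxP/matrixP => i j; rewrite mulB -mulmxA -[x *m _]exprS [RHS]mxE.
  case: j => [[|j] js] /=; first by rewrite subn0 Ws mxE.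
  by have := WB i (Ordinal (ltnW js)); rewrite mulB [RHS]mxE /= subnSK.
- by rewrite -[LHS](mxrank_mul_ker U B) UB.
- pose A := U *m B *m invmx (C *m B).
  have -> : U = A *m C + (U - A *m C) by rewrite addrC subrK.
  apply: addmx_sub_adds; first exact: submxMl.
  rewrite sub_capmx; apply/andP; split.
    by rewrite addmx_sub// eqmx_opp (submx_trans (submxMl _ _)).
  by apply/sub_kermxP; rewrite mulmxBl -mulmxA /A mulmxKV// subrr.
Qed.

(** Splitting off a longest chain leaves a complement on which [x] has no larger
    nilpotency index, so the lengths come out weakly decreasing. *)
Lemma chain_basis k : forall U, (U *m x <= U)%MS -> U *m x ^+ k = 0 ->
  exists l : seq ('rV[F]_n * nat),
    [/\ forall c, c \in l -> c.1 *m x ^+ c.2 = 0 /\ (0 < c.2 <= k)%N,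
        sorted geq (unzip2 l), \sum_(c <- l) c.2 = \rank U
      & (U <= \sum_(c <- l) <<chain c.1 c.2>>)%MS].
Proof.
move=> U; have [r] := ubnP (\rank U); elim: r U k => // r IH U k rU Ux Uk.
have [U0|Un0] := eqVneq U 0.
  by exists [::]; split; rewrite // ?U0 ?mxrank0 ?sub0mx ?big_nil.
have exk : exists s, U *m x ^+ s == 0 by exists k; apply/eqP.
case: (ex_minnP exk) => -[|s] /eqP Us smin.
  by case/eqP: Un0; rewrite -[U]mulmx1 -[1%:M]/(x ^+ 0).
have sk : (s < k)%N by apply: smin; apply/eqP.
have /rowV0Pn[_ /submxP[D ->] Ds] : U *m x ^+ s != 0.
  by apply/negP => /smin; rewrite ltnn.
rewrite mulmxA in Ds.
have [U' [U'U U'x rU' UU']] := chain_complement Ux Us (submxMl D U) Ds.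
have U's : U' *m x ^+ s.+1 = 0.
  by case/submxP: U'U => E ->; rewrite -mulmxA Us mulmx0.
have [|l [lP lsort lr lU]] := IH U' s.+1 _ U'x U's.
  by rewrite -ltnS (leq_trans _ rU)// rU' addSn ltnS; lia.
exists ((D *m U, s.+1) :: l); split.
- move=> c; rewrite inE => /predU1P[->|/lP[-> /andP[-> cs]]] /=.
    by rewrite -mulmxA Us mulmx0 sk.
  by rewrite (leq_trans cs).
- rewrite /= (path_min_sorted) //; apply/allP => _ /mapP[c cl ->].
  by case: (lP c cl) => _ /andP[].
- by rewrite big_cons lr rU'.
- rewrite big_cons (submx_trans UU')// addsmx_sub.
  by rewrite (submx_trans _ (addsmxSl _ _)) ?genmxE// (submx_trans lU) ?addsmxSr.
Qed.

(** The links of the rescaled chain [e_i v x^i] are the ratios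
    [e_i / e_(i+1)]. *)
Lemma rescaled_chain_quasi_jordan s v (e : 'rV[F]_s) :
    v *m x ^+ s = 0 -> (forall j, e 0 j != 0) ->
  exists p : s.-1.-tuple F, 0 \notin p /\
    diag_mx e *m chain v s *m x = quasi_jordan_block p *m (diag_mx e *m chain v s).
Proof.
case: s e => [|s] e vs e0.
  by exists [tuple]; split=> //; apply/matrixP => -[].
pose p := [tuple e 0 (widen_ord (leqnSn s) i) / e 0 (lift ord0 i) | i < s].
exists p; split.
  by apply/mapP => -[i _ /esym/eqP]; rewrite mulf_eq0 invr_eq0 !(negbTE (e0 _)).
have rowE i : row i (diag_mx e *m chain v s.+1) = e 0 i *: (v *m x ^+ i).
  by rewrite row_mul row_diag_mx -scalemxAl -rowE rowK.
apply/row_matrixP => i; rewrite row_mul rowE -scalemxAl -mulmxA -[_ *m x]exprSr.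
rewrite row_mul [RHS]mulmx_sum_row; case: (unliftP ord_max i) => [j ->|->].
  have -> : lift ord_max j = widen_ord (leqnSn s) j.
    by apply: val_inj; rewrite /= /bump leqNgt ltn_ord.
  rewrite (bigD1 (lift ord0 j)) //= big1 => [|l lj]; last first.
    rewrite !mxE /=; case: eqP => [ljE|_]; last by rewrite scale0r.
    by case/eqP: lj; apply: val_inj; rewrite /= ljE.
  rewrite addr0 rowE !mxE lift0 eqxx /= scalerA.
  by rewrite (nth_map j) ?size_enum_ord// nth_ord_enum divfK ?e0.
rewrite vs scaler0 big1 // => l _.
by rewrite !mxE eqn_leq andbC leqNgt (leq_trans (ltn_ord l)) //= scale0r.
Qed.

End Chains.

(** * Quasi-Jordan form of a nilpotent matrix *)

Lemma chain_basis_quasi_jordan (F : fieldType) (n : nat) (x : 'M[F]_n) (d : nat)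
    (s : 'I_d -> nat) (v : 'I_d -> 'rV[F]_n) (sum_s : (\sum_k s k)%N = n) (a : F) :
    (0 < n)%N -> a != 0 -> (forall k, v k *m x ^+ s k = 0) ->
    row_full (\mxcol_k chain x (v k) (s k)) ->
  exists (p : forall k, (s k).-1.-tuple F) (g : 'M_n),
    [/\ forall k, 0 \notin p k, \det g = a
      & g *m x = castmx (sum_s, sum_s) (quasi_jordan p) *m g].
Proof.
case: _ / sum_s x v => x v n0 a0 vs; set G := (\mxcol_k _) => Gfull.
have G0 : \det G != 0 by rewrite -unitfE -unitmxE -row_full_unit.
pose i0 := Ordinal n0.
(* Rescaling the first vector alone is enough to turn the determinant into
   [a]. *)
pose e : 'rV[F]_(\sum_k s k) := \row_i if i == i0 then a / \det G else 1.
have e0 i : e 0 i != 0.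
  by rewrite mxE; case: (i == i0); rewrite ?oner_eq0// mulf_neq0 ?invr_eq0.
pose ek k := submxrow e k.
have ek0 k j : ek k 0 j != 0 by rewrite mxE.
pose pP k := cid (rescaled_chain_quasi_jordan (vs k) (ek0 k)).
exists (fun k => projT1 (pP k)), (diag_mx e *m G); split.
- by move=> k; case: (projT2 (pP k)).
- rewrite det_mulmx det_diag (bigD1 i0) //= mxE eqxx [X in _ * X * _]big1.
    by rewrite mulr1 divfK.
  by move=> i /negbTE ii0; rewrite mxE ii0.
rewrite castmx_id -[e]submxrowK diag_mxrow mul_mxdiag_mxcol mxcol_mul.
rewrite mul_mxdiag_mxcol; apply: eq_mxcol => k.
by case: (projT2 (pP k)).
Qed.

Lemma nilpotent_quasi_jordan (F : fieldType) (n k : nat) (x : 'M[F]_n) (a : F) :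
    (0 < n)%N -> x ^+ k = 0 -> a != 0 ->
  exists (d : nat) (s : 'I_d -> nat) (p : forall k, (s k).-1.-tuple F)
      (sum_s : (\sum_k s k)%N = n) (g : 'M_n),
    [/\ forall k, (0 < s k)%N, forall j k : 'I_d, (j <= k)%N -> (s k <= s j)%N,
        forall k, 0 \notin p k, \det g = a
      & g *m x = castmx (sum_s, sum_s) (quasi_jordan p) *m g].
Proof.
move=> n0 xk a0.
have [||l [lP lsort lr lU]] := @chain_basis F n x k 1%:M.
- exact: submx1.
- by rewrite mul1mx.
pose c0 : 'rV[F]_n * nat := (0, 0%N).
pose c i := nth c0 l i.
pose s (i : 'I_(size l)) := (c i).2; pose v (i : 'I_(size l)) := (c i).1.
have cl (i : 'I_(size l)) : c i \in l by apply: mem_nth.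
have sum_s : (\sum_i s i)%N = n by rewrite -[RHS](mxrank1 F) -lr (big_nth c0) big_mkord.
have [||p [g [p0 gdet gx]]] := @chain_basis_quasi_jordan F n x _ s v sum_s a n0 a0.
- by move=> i; case: (lP _ (cl i)).
- by rewrite -sub1mx (submx_trans lU)// (big_nth c0) big_mkord eqmx_col.
exists (size l), s, p, sum_s, g; split=> //.
- by move=> i; case: (lP _ (cl i)) => _ /andP[].
- move=> i j ij; rewrite /s /c -!(nth_map c0 0%N snd) //.
  apply: (sorted_leq_nth _ _ 0%N lsort) => //; rewrite ?inE ?size_map //.
    by move=> y z w yz /leq_trans; apply.
  exact: leqnn.
Qed.

(** Jordan blocks for the eigenvalue 0 have zero diagonal. *)
Lemma nilpotent_trace0 (F : fieldType) (n k : nat) (x : 'M[F]_n) :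
  x ^+ k = 0 -> \tr x = 0.
Proof.
case: n x => [|n] x xk; first by rewrite /mxtrace big_ord0.
have [d [s [p [sum_s [g [_ _ _ g1 gx]]]]]] :=
  nilpotent_quasi_jordan (ltn0Sn n) xk (oner_neq0 F).
have gu : g \in unitmx by rewrite unitmxE g1 unitr1.
rewrite -[x](mulKmx gu) mxtrace_mulC gx mulmxK //.
case: _ / sum_s {x xk g g1 gx gu}; rewrite castmx_id mxtrace_mxdiag big1 // => i _.
by rewrite /mxtrace big1 // => j _; rewrite mxE ltn_eqF.
Qed.

(** * Vanishing of the degree *)

Lemma iter_kernel (T : Type) (z : T) (P : T -> Prop) (f : T -> T) (k : nat) (y : T) :
    (forall u, P u -> P (f u)) -> P y -> y <> z -> iter k f y = z ->
  exists u, [/\ P u, u <> z & f u = z].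
Proof.
move=> Pf; elim: k y => [|k IH] y Py yz //; rewrite iterSr.
have [fz _|fz] := pselect (f y = z); first by exists y.
exact: IH (Pf _ Py) fz.
Qed.

(** The bracket has no [d]-component, so the terms coming from the degree of the
    second argument never occur. *)
Lemma iter_bracket_mx (F : fieldType) (n k : nat) (x y : 'M[laurent F]_n)
    (lambda mu : F) :
  (iter k (bracket (x, lambda, mu)) (y, 0, 0)).1.1 =
  iter k (fun y => lie x y + (laurent_const mu * laurent_t F) *: dt y) y
  /\ (iter k (bracket (x, lambda, mu)) (y, 0, 0)).2 = 0.
Proof.
elim: k => //= k [<-].
case: (iter _ _ _) => [[y' l] m] /= ->.
by rewrite rmorph0 mul0r scale0r subr0.
Qed.

(** A nilpotent [D] kills some nonzero [y], and then the Leibniz rule gives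
    [D (t y) = mu t y], so that [t y] is killed by no power of [D] unless [mu]
    is zero. *)
Lemma derivation_nilpotent_degree0 (F : fieldType) (n k : nat)
    (x : 'M[laurent F]_n) (mu : F) : (1 < n)%N ->
    (forall y, y \in sl (laurent F) n ->
       iter k (fun y => lie x y + (laurent_const mu * laurent_t F) *: dt y) y = 0) ->
  mu = 0.
Proof.
move=> n1 Dk; apply/eqP/negPn/negP => mu0.
pose t := laurent_t F.
set D := (fun y : 'M_n => _) in Dk.
have t0 : t != 0.
  by apply/eqP => /laurentP/(_ 1)/=/eqP; rewrite oner_eq0.
have t' : laurent_deriv t = 1.
  apply/laurentP => j /=; rewrite -[1]/(0 + 1 : int) (inj_eq (addIr 1)).
  by case: eqP => [->|_]; rewrite ?mul0rz.
have Dsl y : y \in sl (laurent F) n -> D y \in sl (laurent F) n.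
  rewrite slE => /eqP y0; rewrite rpredD ?lie_sl// rpredZ// slE.
  rewrite /mxtrace; under eq_bigr do rewrite mxE.
  by rewrite -raddf_sum -/(mxtrace y) y0 raddf0.
(* [sl_n] is nonzero because n > 1. *)
pose i0 := Ordinal (ltnW n1); pose i1 := Ordinal n1.
have Esl : delta_mx i0 i1 \in sl (laurent F) n.
  rewrite slE /mxtrace big1 // => i _; rewrite mxE.
  by case: eqP => // ->.
have E0 : delta_mx i0 i1 <> 0 :> 'M[laurent F]_n.
  by move=> /matrixP/(_ i0 i1)/eqP; rewrite !mxE !eqxx oner_eq0.
have [y [sy /eqP y0 Dy]] := iter_kernel Dsl Esl E0 (Dk _ Esl).
(* The induction runs over all [u] with [t u' = u] because [D] turns [u y] into
   [mu u y], and [mu u] satisfies this equation again. *)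
have Diter m u : t * laurent_deriv u = u ->
    iter m D (u *: y) = (laurent_const mu ^+ m * u) *: y.
  elim: m u => [|m IH] u tu; first by rewrite expr0 mul1r.
  have dtZ : dt (u *: y) = laurent_deriv u *: y + u *: dt y.
    by apply/matrixP => i j; rewrite !mxE laurent_derivM.
  have Du : D (u *: y) = (laurent_const mu * u) *: y.
    rewrite -[LHS]/(lie x (u *: y) + (laurent_const mu * t) *: dt (u *: y)).
    rewrite lieZr dtZ [(_ * t) *: _]scalerDr !scalerA -mulrA tu.
    rewrite addrCA [_ * t * u]mulrC.
    by rewrite -(scalerA u) -(scalerDr u) -[lie x y + _]/(D y) Dy scaler0 addr0.
  rewrite iterSr Du IH; first by rewrite mulrA exprSr.
  have c' : laurent_deriv (laurent_const mu) = 0.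
    apply/laurentP => j /=; case: eqP => [->|_]; first by rewrite mulr0z.
    by rewrite mul0rz.
  by rewrite laurent_derivM c' mul0r add0r mulrCA tu.
have := Dk (t *: y); rewrite Diter ?t' ?mulr1// => /(_ _)/eqP.
rewrite scaler_eq0 (negbTE y0) orbF mulf_eq0 expf_eq0 fmorph_eq0 (negbTE mu0) andbF.
by rewrite (negbTE t0) /= => /(_ (rpredZ t sy)).
Qed.

(** * Nilpotency of a traceless ad-nilpotent matrix *)

Lemma exists_irreducible_factor (F : fieldType) (q : {poly F}) :
  (1 < size q)%N -> exists2 p, irreducible_poly p & p %| q.
Proof.
have [m] := ubnP (size q); elim: m q => // m IH q qm q1.
have [|/existsNP[r /not_implyP[r1 /not_implyP[rq rNq]]]] :=
  pselect (forall r : {poly F}, size r != 1%N -> r %| q -> r %= q).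
  by move=> qirr; exists q; rewrite ?dvdpp.
have q0 : q != 0 by rewrite -size_poly_gt0 ltnW.
have r0 : r != 0 by apply: contraTneq rq => ->; rewrite dvd0p.
have rltq : (size r < size q)%N.
  rewrite ltn_neqAle dvdp_leq// andbT; apply/negP => rq'.
  by apply: rNq; rewrite -dvdp_size_eqp.
have [||p pirr pr] := IH r.
- exact: leq_trans rltq _.
- by rewrite ltn_neqAle eq_sym r1 size_poly_gt0.
by exists p; rewrite // (dvdp_trans pr).
Qed.

Lemma eigenvalue_in_extension (F : fieldType) (n : nat) (x : 'M[F]_n) :
  (0 < n)%N -> exists (L : fieldExtType F) (z : L),
    eigenvalue (map_mx (in_alg L) x) z.
Proof.
move=> n0; have [|p pirr /dvdpP[q qp]] := @exists_irreducible_factor F (char_poly x).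
  by rewrite size_char_poly ltnS.
have [L _ [z pz _]] := irredp_FAdjoin pirr.
exists L, z; rewrite eigenvalue_root_char -map_char_poly qp rmorphM rootM.
by rewrite [X in _ || X]pz orbT.
Qed.

(** For a row eigenvector [v] and any column [w], [ad x] sends [w v] to
    [((x - z) w) v]. *)
Lemma lie_nilpotent_eigenvalue (F : fieldType) (n k : nat) (x : 'M[F]_n) (z : F) :
    eigenvalue x z -> (forall y, iter k (lie x) y = 0) ->
  (x - z%:M) ^+ k = 0.
Proof.
move=> /eigenvalueP[v vx v0] adk.
have iterE (w : 'cV[F]_n) : iter k (lie x) (w *m v) = (x - z%:M) ^+ k *m w *m v.
  elim: k {adk} => [|k /= ->]; first by rewrite expr0 mul1mx.
  by rewrite exprS -mulmxE /lie -!mulmxA vx -!scalemxAr mulmxBl mul_scalar_mx.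
have /rV0Pn[j vj] := v0.
apply/row_matrixP => i; apply/rowP => l.
have /matrixP/(_ i j) := iterE (delta_mx l 0); rewrite adk.
rewrite -colE [RHS]mxE big_ord1 !mxE => /esym/eqP.
by rewrite mulf_eq0 (negbTE vj) orbF => /eqP.
Qed.

(** By linearity it is enough to test the elementary matrices, which have entries
    in the smaller field. *)
Lemma lie_nilpotent_extension (F L : fieldType) (f : {rmorphism F -> L}) (n k : nat)
    (x : 'M[F]_n) : (forall y, iter k (lie x) y = 0) ->
  forall y, iter k (lie (map_mx f x)) y = 0.
Proof.
move=> adk y.
have iterD u v : iter k (lie (map_mx f x)) (u + v) =
    iter k (lie (map_mx f x)) u + iter k (lie (map_mx f x)) v.
  by elim: k {adk} => //= k ->; rewrite lieDr.
have iterZ c u : iter k (lie (map_mx f x)) (c *: u) =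
    c *: iter k (lie (map_mx f x)) u.
  by elim: k {adk iterD} => //= k ->; rewrite lieZr.
have iterM u : iter k (lie (map_mx f x)) (map_mx f u) = map_mx f (iter k (lie x) u).
  by elim: k {adk iterD iterZ} => //= k ->; rewrite map_mxB !map_mxM.
have iter0 : iter k (lie (map_mx f x)) 0 = 0.
  by rewrite -[X in iter _ _ X](scale0r 0) iterZ scale0r.
rewrite [y]matrix_sum_delta.
rewrite (big_morph _ iterD iter0) big1 // => i _.
rewrite (big_morph _ iterD iter0) big1 // => j _.
by rewrite iterZ -(map_delta_mx f) iterM adk map_mx0 scaler0.
Qed.

Lemma lie_nilpotent_traceless (F : fieldType) (n k : nat) (x : 'M[F]_n) :
    n%:R != 0 :> F -> \tr x = 0 -> (forall y, iter k (lie x) y = 0) ->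
  x ^+ k = 0.
Proof.
move=> n0 x0 adk.
have n_gt0 : (0 < n)%N by case: n n0 {x x0 adk} => //; rewrite eqxx.
have [L [z xz]] := eigenvalue_in_extension x n_gt0.
have xzk := lie_nilpotent_eigenvalue xz (lie_nilpotent_extension _ adk).
have /eqP := nilpotent_trace0 xzk.
rewrite linearB /= trace_map_mx x0 rmorph0 sub0r oppr_eq0 mxtrace_scalar.
rewrite -mulr_natl mulf_eq0 -(rmorph_nat (in_alg L)) fmorph_eq0 (negbTE n0) /= => /eqP z0.
move: xzk; rewrite z0 raddf0 subr0.
have mapX m : map_mx (in_alg L) x ^+ m = map_mx (in_alg L) (x ^+ m).
  elim: m => [|m IH]; first by rewrite !expr0 map_mx1.
  by rewrite !exprS IH -!mulmxE map_mxM.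
by rewrite mapX => /eqP; rewrite map_mx_eq0 => /eqP.
Qed.

(** * The theorem *)

Theorem theorem5p1 (R : realType) (n : nat) (hn : (1 < n)%N)
    (X : affine R[i] n) (hX : affine_poly X) (nilX : ad_nilpotent X) :
  exists (h : loop_group R[i] n) (d : nat) (s : 'I_d -> nat)
         (p : forall k : 'I_d, (s k).-1.-tuple (laurent R[i]))
         (sum_s : (\sum_(k < d) s k)%N = n) (lambda : R[i]),
    [/\ forall k : 'I_d, (0 < s k)%N,
        forall j k : 'I_d, (j <= k)%N -> (s k <= s j)%N,
        forall k : 'I_d, 0 \notin p k
      & Ad h X = (castmx (sum_s, sum_s) (quasi_jordan p), lambda, 0)].
Proof.
case: X hX nilX => [[x lambda] mu] [xsl _] [k adX].
have x0 : \tr x = 0 by apply/eqP; rewrite -slE.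
have Dk y : y \in sl (laurent R[i]) n ->
    iter k (fun y => lie x y + (laurent_const mu * laurent_t R[i]) *: dt y) y = 0.
  by move=> sy; case: (iter_bracket_mx k x y lambda mu) => <- _; rewrite adX.
have mu0 := derivation_nilpotent_degree0 hn Dk; subst mu.
(* One more bracket brings an arbitrary matrix into [sl_n]. *)
have adk y : iter k.+1 (lie x) y = 0.
  rewrite iterSr -[RHS](Dk _ (lie_sl x y)); apply: eq_iter => u.
  by rewrite rmorph0 mul0r scale0r addr0.
have nK : n%:R != 0 :> laurent R[i].
  by rewrite -(rmorph_nat (@laurent_const _)) fmorph_eq0 pnatr_eq0 -lt0n ltnW.
have xk := lie_nilpotent_traceless nK x0 adk.
have [d [s [p [sum_s [g [s0 smono p0 g1 gx]]]]]] :=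
  nilpotent_quasi_jordan (ltnW hn) xk (oner_neq0 _).
exists (LoopGroup (oner_neq0 _) g1), d, s, p, sum_s; eexists; split=> //.
rewrite /Ad /= map_rescale_id rmorph0 mul0r scale0r subr0 gx mulmxK //.
by rewrite unitmxE g1 unitr1.
Qed.
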